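(* Let $G$ be a connected graph and let $v\in V(G)$ be a vertex that is not a cut vertex of $G$. Then $$\chi_d^t(G)-2\leq \chi_d^t(G-v)\leq \chi_d^t(G)+\deg(v)-1.$$
   Context: All graphs are simple and finite. For a graph $H$ with no isolated vertex, a total dominator coloring (TD-coloring) of $H$ is a proper vertex coloring of $H$ in which every vertex is adjacent to every vertex of some color class (a class other than its own). The total dominator chromatic number $\chi_d^t(H)$ is the minimum number of colors in a TD-coloring of $H$. $G-v$ is the graph obtained from $G$ by deleting $v$ and all edges incident to $v$. Implicitly, every graph whose $\chi_d^t$ appears has no isolated vertex. *)

(* Defs.v *)
From mathcomp Require Import all_boot.

Set Implicit Arguments.
Unset Strict Implicit.
Unset Printing Implicit Defensive.

Record sgraph := SGraph {
  vertex :> finType;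
  adj : rel vertex;
  adj_sym : symmetric adj;
  adj_irr : irreflexive adj
}.

Section Graph.
Variable H : sgraph.

Definition degree (x : H) : nat := #|[set y | adj x y]|.

Definition no_isolated : bool := [forall x : H, exists y : H, adj x y].

Definition connected : bool :=
  (0 < #|H|) && [forall x : H, forall y : H, connect (@adj H) x y].

Definition num_components : nat := n_comp (@adj H) H.

Definition proper_coloring k (c : {ffun H -> 'I_k}) : bool :=
  [forall x : H, forall y : H, adj x y ==> (c x != c y)].

Definition color_class k (c : {ffun H -> 'I_k}) (i : 'I_k) : {set H} :=
  [set x | c x == i].

(* The map c need not be onto, so an unused color has to be excluded as a
   dominated class, since every vertex would dominate it vacuously. *)
Definition td_coloring k (c : {ffun H -> 'I_k}) : bool :=
  proper_coloring c &&
  [forall x : H, exists i : 'I_k,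
    [&& i != c x, color_class c i != set0
      & [forall y in color_class c i, adj x y]]].

Definition td_colorable k : bool :=
  [exists c : {ffun H -> 'I_k}, td_coloring c].

Lemma ex_td_colorable : no_isolated -> exists k, td_colorable k.
Proof.
move=> /forallP hH; exists #|H|; apply/existsP.
exists [ffun x => enum_rank x]; apply/andP; split.
  apply/forallP=> x; apply/forallP=> y; apply/implyP=> xy.
  rewrite !ffunE (inj_eq enum_rank_inj).
  by apply: contraTneq xy => ->; rewrite adj_irr.
apply/forallP=> x; have /existsP[y xy] := hH x.
apply/existsP; exists (enum_rank y); apply/and3P; split.
- rewrite ffunE (inj_eq enum_rank_inj).
  by apply: contraTneq xy => ->; rewrite adj_irr.
- by apply/set0Pn; exists y; rewrite inE ffunE.
- apply/forall_inP=> z; rewrite inE ffunE (inj_eq enum_rank_inj).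
  by move=> /eqP ->.
Qed.

Definition td_chromatic (hH : no_isolated) : nat :=
  ex_minn (ex_td_colorable hH).

End Graph.

Section Delete.
Variables (G : sgraph) (v : G).

Definition del_adj : rel {x : G | x != v} := fun x y => adj (val x) (val y).

Lemma del_adj_sym : symmetric del_adj.
Proof. by move=> x y; apply: adj_sym. Qed.

Lemma del_adj_irr : irreflexive del_adj.
Proof. by move=> x; apply: adj_irr. Qed.

Definition del_vertex : sgraph := SGraph del_adj_sym del_adj_irr.

Definition cut_vertex : bool :=
  num_components G < num_components del_vertex.

End Delete.

(* Main.v *)
(** Recoloring the vertices of a set S with fresh private colors never hurts
    domination: a vertex that dominated a class either still dominates what is
    left of it outside S, or is adjacent to a new singleton class. For the lower
    bound take S to be v and one of its neighbors. For the upper bound, if v is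
    not alone in its class, then the restriction of the coloring of G already
    works; otherwise the color of v is saved, and choosing for S one neighbor in
    G - v of each neighbor of v costs at most deg v colors. *)
Require Import Defs.
From mathcomp Require Import all_boot.

Set Implicit Arguments.
Unset Strict Implicit.
Unset Printing Implicit Defensive.

Section Coloring.
Variable H : sgraph.

(* A dominated class is given by a member y, and is never the class of x
   itself since x is not adjacent to x. *)
Lemma td_colorable_fun (T : finType) (g : H -> T) :
    (forall x y, adj x y -> g x != g y) ->
    (forall x, exists y, forall z, g z = g y -> adj x z) ->
  td_colorable H #|T|.
Proof.
move=> gP gD; apply/existsP; exists [ffun x => enum_rank (g x)].
apply/andP; split.
  apply/forallP=> x; apply/forallP=> y; apply/implyP=> xy.
  by rewrite !ffunE (inj_eq enum_rank_inj) gP.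
apply/forallP=> x; have [y yP] := gD x.
apply/existsP; exists (enum_rank (g y)); apply/and3P; split.
- rewrite ffunE (inj_eq enum_rank_inj); apply/eqP=> yx.
  by have := yP x (esym yx); rewrite adj_irr.
- by apply/set0Pn; exists y; rewrite inE ffunE.
- apply/forall_inP=> z; rewrite inE ffunE (inj_eq enum_rank_inj).
  by move=> /eqP /yP.
Qed.

Lemma td_colorableP k : td_colorable H k ->
  exists c : H -> 'I_k, (forall x y, adj x y -> c x != c y) /\
    (forall x, exists y, forall z, c z = c y -> adj x z).
Proof.
move=> /existsP[c /andP[/forallP cP /forallP cD]]; exists c; split=> [x y xy|x].
  by have /forallP/(_ y)/implyP := cP x; apply.
have /existsP[i /and3P[_ /set0Pn[y yi] /forall_inP iP]] := cD x.
exists y => z zy; apply: iP; move: yi; rewrite !inE => /eqP <-.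
exact/eqP.
Qed.

Lemma td_colorable_recolor (T : finType) (f : H -> T) (S : {set H}) :
    (forall x y, x \notin S -> y \notin S -> adj x y -> f x != f y) ->
    (forall x, (exists2 s, s \in S & adj x s) \/
      (exists2 y, y \notin S &
        forall z, z \notin S -> f z = f y -> adj x z)) ->
  td_colorable H (#|T| + #|S|).
Proof.
move=> fP fD.
pose g x : T + {x | x \in S} := if insub x is Some s then inr s else inl (f x).
have gS x s : x \in S -> g s = g x -> s = x.
  move=> xS; rewrite /g (insubT (mem S) xS).
  by case: insubP => // u _ us [ux]; rewrite -us ux.
have gN x : x \notin S -> g x = inl (f x) by move=> xS; rewrite /g insubN.
have gNS x y : y \notin S -> g x = g y -> x \notin S.
  move=> yS gxy; apply/negP=> xS.
  by move: yS; rewrite (gS _ _ xS (esym gxy)) xS.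
have -> : #|T| + #|S| = #|{: T + {x | x \in S}}| by rewrite card_sum card_sig.
apply: (@td_colorable_fun _ g) => [x y xy|x].
  have [yS|yS] := boolP (y \in S).
    by apply: contraTneq xy => /(gS _ _ yS) ->; rewrite adj_irr.
  apply/eqP=> gxy; have xS := gNS _ _ yS gxy.
  by move: gxy; rewrite !gN // => -[/eqP]; apply/negP/fP.
case: (fD x) => [[s sS xs]|[y yS yP]].
  by exists s => z /(gS _ _ sS) ->.
exists y => z gzy; have zS := gNS _ _ yS gzy.
by apply: yP => //; move: gzy; rewrite !gN // => -[].
Qed.

Lemma td_chromatic_colorable (hH : no_isolated H) :
  td_colorable H (td_chromatic hH).
Proof. by rewrite /td_chromatic; case: ex_minnP. Qed.

Lemma td_chromatic_le (hH : no_isolated H) k :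
  td_colorable H k -> td_chromatic hH <= k.
Proof. by rewrite /td_chromatic; case: ex_minnP => m _; apply. Qed.

End Coloring.

Section Delete.
Variables (G : sgraph) (v : G).

Lemma neighbor_del x : adj v x -> x != v.
Proof. by apply: contraTneq => ->; rewrite adj_irr. Qed.

Lemma td_colorable_undelete k :
  no_isolated G -> td_colorable (del_vertex v) k -> td_colorable G (k + 2).
Proof.
move=> /forallP/(_ v)/existsP[w vw] /td_colorableP[c [cP cD]].
have wv := neighbor_del vw.
pose w' : del_vertex v := exist _ w wv.
(* The default [w'] only gives [v] a junk color, which is harmless because [v] gets recolored. *)
pose f x := c (insubd w' x).
have fE (x : del_vertex v) : f (val x) = c x by rewrite /f valKd.
have -> : k + 2 = #|'I_k| + #|[set v; w]|.
  by rewrite card_ord cards2 eq_sym wv.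
apply: (@td_colorable_recolor _ _ f).
  move=> x y; rewrite !inE !negb_or => /andP[xv _] /andP[yv _] xy.
  by rewrite -[x](SubK (del_vertex v) xv) -[y](SubK (del_vertex v) yv) !fE cP.
move=> x; have [->|xv] := eqVneq x v.
  by left; exists w; rewrite // !inE eqxx orbT.
have [y yP] := cD (exist _ x xv).
(* If the representative is [w], then [x] is adjacent to [w] and the private class of [w] serves.
   Otherwise the representative keeps its color, and [x] dominates what is left of the class. *)
have xy := yP y erefl; have [yw|yw] := eqVneq (val y) w.
  by left; exists w; rewrite ?inE ?eqxx ?orbT // -yw.
right; exists (val y); first by rewrite !inE negb_or (valP y).
move=> z; rewrite !inE negb_or => /andP[zv _].
by rewrite -[z](SubK (del_vertex v) zv) !fE => /yP.
Qed.

(** Deleting [v] empties no class: that of [v] still contains [u], which can replace [v] as its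
    representative. *)
Lemma td_colorable_delete_shared (k : nat) (c : G -> 'I_k) (u : G) :
    (forall x y, adj x y -> c x != c y) ->
    (forall x, exists y, forall z, c z = c y -> adj x z) ->
    u != v -> c u = c v ->
  td_colorable (del_vertex v) k.
Proof.
move=> cP cD uv cuv; rewrite -[k]card_ord.
apply: (@td_colorable_fun (del_vertex v) _ (fun x => c (val x))) => [x y|x].
  exact: cP.
have [y yP] := cD (val x).
have [yv|yv] := eqVneq y v.
  by exists (exist _ u uv) => z zu; apply: yP; rewrite yv -cuv.
by exists (exist _ y yv) => z /yP.
Qed.

Lemma td_colorable_delete_alone (k : nat) (c : G -> 'I_k) :
    no_isolated (del_vertex v) ->
    (forall x y, adj x y -> c x != c y) ->
    (forall x, exists y, forall z, c z = c y -> adj x z) ->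
    (forall u, u != v -> c u != c v) ->
  exists2 m, m <= degree v & td_colorable (del_vertex v) (k.-1 + m).
Proof.
move=> hGv cP cD cv.
have nb (x : del_vertex v) : exists y, adj x y.
  exact/existsP/(forallP hGv).
pose p x := xchoose (nb x).
have pP x : adj x (p x) by apply: xchooseP.
pose N := [set x : del_vertex v | adj v (val x)].
(* Neighbors of [v] may share a value of [p], so the new colors are counted by the image, which can
   be smaller than [degree v]. *)
exists #|p @: N|.
  apply: leq_trans (leq_imset_card _ _) _.
  rewrite -(card_imset _ val_inj); apply/subset_leq_card/subsetP => u.
  by move=> /imsetP[x xN ->]; move: xN; rewrite !inE.
pose f (x : del_vertex v) : {i | i != c v} :=
    exist (fun i => i != c v) _ (cv _ (valP x)).
have -> : k.-1 = #|{: {i | i != c v}}|.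
  by rewrite card_sig cardC1 card_ord.
apply: (@td_colorable_recolor _ _ f) => [x y _ _|x].
  exact: cP.
have [vx|vx] := boolP (adj v (val x)).
  by left; exists (p x) => //; apply: imset_f; rewrite inE.
have [y yP] := cD (val x).
(* A vertex not adjacent to [v] cannot dominate the class of [v], so its representative survives the
   deletion. *)
have yv : y != v.
  by apply: contraNneq vx => yv; rewrite adj_sym; apply: yP; rewrite yv.
pose y' : del_vertex v := exist _ y yv.
have [yS|yS] := boolP (y' \in p @: N).
  by left; exists y' => //; apply: yP.
by right; exists y' => // z _ [] /yP.
Qed.

End Delete.

Theorem theorem2p3 (G : sgraph) (v : G)
  (hG : no_isolated G) (hGv : no_isolated (del_vertex v))
  (conG : connected G) (vNcut : ~~ cut_vertex v) :
  td_chromatic hG - 2 <= td_chromatic hGv /\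
  td_chromatic hGv <= td_chromatic hG + degree v - 1.
Proof.
split.
  rewrite leq_subLR addnC; apply: td_chromatic_le.
  exact/td_colorable_undelete/td_chromatic_colorable.
(* This lets the truncated subtraction of 1 be charged to the degree when no color is saved. *)
have deg_gt0 : 0 < degree v.
  have /existsP[w vw] := forallP hG v.
  by apply/card_gt0P; exists w; rewrite inE.
have [c [cP cD]] := td_colorableP (td_chromatic_colorable hG).
have [/existsP[u /andP[uv /eqP cuv]]|cv] :=
  boolP [exists u, (u != v) && (c u == c v)].
  rewrite -addnBA //; apply: leq_trans (leq_addr _ _).
  exact/td_chromatic_le/(td_colorable_delete_shared cP cD uv cuv).
have{}cv u : u != v -> c u != c v.
  by move=> uv; move: cv; rewrite negb_exists => /forallP/(_ u); rewrite uv.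
have [m m_le /(td_chromatic_le hGv) le_m] :=
  td_colorable_delete_alone hGv cP cD cv.
apply: leq_trans le_m _.
(* The color of [v] shows that there is a color to save, so the predecessor is a genuine
   decrease. *)
have k_gt0 : 0 < td_chromatic hG by apply: leq_ltn_trans (ltn_ord (c v)).
by rewrite subn1 -(prednK k_gt0) addSn /= leq_add2l.
Qed.
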